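(* Let $\mathcal C$ be a homological category and let $\mathcal X$ be a full reflective subcategory of $\mathcal C$, with inclusion $U\colon\mathcal X\to\mathcal C$, reflector (left adjoint) $F\colon\mathcal C\to\mathcal X$ and unit $\eta\colon 1_{\mathcal C}\Rightarrow UF$. If $L=UF\colon\mathcal C\to\mathcal C$ is conditionally flat, then the reflector $F\colon\mathcal C\to\mathcal X$ is admissible for the class of regular epimorphisms.
   Context: A category is regular if it is finitely complete, every morphism factors as a regular epimorphism followed by a monomorphism, and regular epimorphisms are stable under pullback. A homological category is a pointed regular category (zero object $0$) in which the Split Short Five Lemma holds: for any morphism $(u,v,w)$ between split epimorphisms (with chosen kernels, and compatible with the splittings), $u\colon K\to K'$ on kernels, $v\colon A\to A'$, $w\colon B\to B'$, if $u$ and $w$ are isomorphisms then so is $v$. An extension in $\mathcal C$ is a short exact sequence $0\to K\to E\to Q\to 0$ (the first map is a kernel of the second, the second is a cokernel of the first). An extension is $L$-flat if $0\to L(K)\to L(E)\to L(Q)\to 0$ is again an extension. The functor $L$ is conditionally flat if every pullback of an $L$-flat extension is $L$-flat: for every $L$-flat extension $0\to K\to E\to Q\to 0$ and every morphism $X\to Q$, the induced extension $0\to K\to E\times_Q X\to X\to 0$ is $L$-flat. The reflector $F$ is admissible for the class of regular epimorphisms if, for every object $X$ of $\mathcal C$ and every morphism $x\colon E\to F(X)$ in $\mathcal X$ such that $U(x)$ is a regular epimorphism in $\mathcal C$, the functor $F$ preserves the pullback $P=X\times_{UF(X)}U(E)$ of $\eta_X\colon X\to UF(X)$ and $U(x)\colon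 U(E)\to UF(X)$. *)

(* Defs.v *)
From Stdlib Require Import FinFun.

Set Implicit Arguments.
Unset Strict Implicit.
Unset Printing Implicit Defensive.

Declare Scope cat_scope.
Delimit Scope cat_scope with cat.
Local Open Scope cat_scope.

(* Morphisms are compared by Leibniz equality; objects are never compared. *)
Record category := Category {
  obj :> Type;
  hom : obj -> obj -> Type;
  idm : forall A, hom A A;
  comp : forall A B C, hom B C -> hom A B -> hom A C;
  comp_idl : forall A B (f : hom A B), comp (idm B) f = f;
  comp_idr : forall A B (f : hom A B), comp f (idm A) = f;
  comp_assoc : forall A B C D (h : hom C D) (g : hom B C) (f : hom A B),
    comp h (comp g f) = comp (comp h g) f
}.

Arguments hom {c} A B.
Arguments idm {c} A.
Arguments comp {c A B C} g f.

Notation "g ∘ f" := (comp g f) (at level 40, left associativity) : cat_scope.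

Record functor (C D : category) := Functor {
  fobj :> C -> D;
  fmap : forall A B : C, hom A B -> hom (fobj A) (fobj B);
  fmap_id : forall A : C, fmap (idm A) = idm (fobj A);
  fmap_comp : forall (A B E : C) (g : hom B E) (f : hom A B),
    fmap (g ∘ f) = fmap g ∘ fmap f
}.

Arguments fmap {C D} f {A B} _ : rename.

Definition functor_id (C : category) : functor C C :=
  @Functor C C (fun A => A) (fun _ _ f => f)
    (fun _ => eq_refl) (fun _ _ _ _ _ => eq_refl).

Definition functor_comp (C D E : category) (G : functor D E) (F : functor C D) :
  functor C E :=
  @Functor C E (fun A => G (F A)) (fun _ _ f => fmap G (fmap F f))
    (fun A => eq_trans (f_equal (fun f => fmap G f) (fmap_id F A))
                       (fmap_id G (F A)))
    (fun _ _ _ g f => eq_trans (f_equal (fun h => fmap G h) (fmap_comp F g f))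
                               (fmap_comp G (fmap F g) (fmap F f))).

Record nat_trans (C D : category) (F G : functor C D) := NatTrans {
  component :> forall A : C, hom (F A) (G A);
  naturality : forall (A B : C) (f : hom A B),
    component B ∘ fmap F f = fmap G f ∘ component A
}.

(* The full subcategory on the objects satisfying P; it is not assumed to be
   closed under isomorphism. *)
Definition full_subcategory (C : category) (P : C -> Prop) : category :=
  @Category {A : C | P A}
    (fun A B => hom (proj1_sig A) (proj1_sig B))
    (fun A => idm (proj1_sig A))
    (fun _ _ _ g f => g ∘ f)
    (fun _ _ f => comp_idl f)
    (fun _ _ f => comp_idr f)
    (fun _ _ _ _ h g f => comp_assoc h g f).

Definition inclusion (C : category) (P : C -> Prop) :
  functor (full_subcategory P) C :=
  @Functor (full_subcategory P) C (fun A => proj1_sig A) (fun _ _ f => f)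
    (fun _ => eq_refl) (fun _ _ _ _ _ => eq_refl).

(* eta is the unit of an adjunction with left adjoint F and right adjoint U. *)
Definition adjunction_unit (C X : category) (F : functor C X) (U : functor X C)
    (eta : nat_trans (functor_id C) (functor_comp U F)) : Prop :=
  forall (A : C) (Y : X) (f : hom A (U Y)),
    exists! g : hom (F A) Y, fmap U g ∘ eta A = f.

Section Limits.
Variable C : category.

Definition mono (A B : C) (m : hom A B) : Prop :=
  forall (T : C) (a b : hom T A), m ∘ a = m ∘ b -> a = b.

Definition iso (A B : C) (f : hom A B) : Prop :=
  exists g : hom B A, g ∘ f = idm A /\ f ∘ g = idm B.

Definition is_limit (J : category) (D : functor J C)
    (A : C) (pi : forall j : J, hom A (D j)) : Prop :=
  (forall (i j : J) (a : hom i j), fmap D a ∘ pi i = pi j) /\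
  forall (T : C) (t : forall j : J, hom T (D j)),
    (forall (i j : J) (a : hom i j), fmap D a ∘ t i = t j) ->
    exists! u : hom T A, forall j : J, pi j ∘ u = t j.

Definition is_pullback (A B S P : C) (f : hom A S) (g : hom B S)
    (p : hom P A) (q : hom P B) : Prop :=
  f ∘ p = g ∘ q /\
  forall (T : C) (a : hom T A) (b : hom T B), f ∘ a = g ∘ b ->
    exists! u : hom T P, p ∘ u = a /\ q ∘ u = b.

Definition is_coequalizer (R A B : C) (a b : hom R A) (f : hom A B) : Prop :=
  f ∘ a = f ∘ b /\
  forall (T : C) (t : hom A T), t ∘ a = t ∘ b ->
    exists! u : hom B T, u ∘ f = t.

Definition regular_epi (A B : C) (f : hom A B) : Prop :=
  exists (R : C) (a b : hom R A), is_coequalizer a b f.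

Definition is_zero_object (Z : C) : Prop :=
  forall T : C, (exists! f : hom T Z, True) /\ (exists! f : hom Z T, True).

Definition zero_morphism (A B : C) (f : hom A B) : Prop :=
  exists Z : C, is_zero_object Z /\
    exists (h : hom Z B) (g : hom A Z), f = h ∘ g.

Definition is_kernel (K A B : C) (k : hom K A) (f : hom A B) : Prop :=
  zero_morphism (f ∘ k) /\
  forall (T : C) (t : hom T A), zero_morphism (f ∘ t) ->
    exists! u : hom T K, k ∘ u = t.

Definition is_cokernel (A B Q : C) (q : hom B Q) (f : hom A B) : Prop :=
  zero_morphism (q ∘ f) /\
  forall (T : C) (t : hom B T), zero_morphism (t ∘ f) ->
    exists! u : hom Q T, u ∘ q = t.

Definition extension (K E Q : C) (k : hom K E) (q : hom E Q) : Prop :=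
  is_kernel k q /\ is_cokernel q k.

End Limits.

Definition finite_category (J : category) : Prop :=
  Finite J /\ forall i j : J, Finite (hom i j).

Definition finitely_complete (C : category) : Prop :=
  forall (J : category) (D : functor J C), finite_category J ->
    exists (A : C) (pi : forall j : J, hom A (D j)), is_limit pi.

Record regular (C : category) : Prop := Regular {
  regular_finitely_complete : finitely_complete C;
  regular_factorization : forall (A B : C) (f : hom A B),
    exists (I : C) (e : hom A I) (m : hom I B),
      regular_epi e /\ mono m /\ f = m ∘ e;
  regular_epi_stable : forall (A B S P : C) (f : hom A S) (g : hom B S)
      (p : hom P A) (q : hom P B),
    is_pullback f g p q -> regular_epi f -> regular_epi q
}.

Definition split_short_five (C : category) : Prop :=
  forall (K A B K' A' B' : C)
    (k : hom K A) (p : hom A B) (s : hom B A)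
    (k' : hom K' A') (p' : hom A' B') (s' : hom B' A')
    (u : hom K K') (v : hom A A') (w : hom B B'),
    p ∘ s = idm B -> is_kernel k p ->
    p' ∘ s' = idm B' -> is_kernel k' p' ->
    v ∘ k = k' ∘ u -> w ∘ p = p' ∘ v -> v ∘ s = s' ∘ w ->
    iso u -> iso w -> iso v.

Record homological (C : category) : Prop := Homological {
  homological_pointed : exists Z : C, is_zero_object Z;
  homological_regular : regular C;
  homological_split_short_five : split_short_five C
}.

Definition flat (C : category) (L : functor C C) (K E Q : C)
    (k : hom K E) (q : hom E Q) : Prop :=
  extension (fmap L k) (fmap L q).

(* The kernel part k' : K -> P of the pulled back extension is the morphism
   into the pullback P induced by k and the zero morphism K -> X. *)
Definition conditionally_flat (C : category) (L : functor C C) : Prop :=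
  forall (K E Q : C) (k : hom K E) (q : hom E Q),
    extension k q -> flat L k q ->
    forall (X P : C) (x : hom X Q) (p : hom P E) (q' : hom P X) (k' : hom K P),
      is_pullback q x p q' -> p ∘ k' = k -> zero_morphism (q' ∘ k') ->
      flat L k' q'.

Definition admissible_regular_epi (C X : category)
    (F : functor C X) (U : functor X C)
    (eta : nat_trans (functor_id C) (functor_comp U F)) : Prop :=
  forall (A : C) (E : X) (x : hom E (F A)), regular_epi (fmap U x) ->
    forall (P : C) (p : hom P A) (q : hom P (U E)),
      is_pullback (eta A : hom A (U (F A))) (fmap U x) p q ->
      is_pullback (fmap F (eta A : hom A (U (F A)))) (fmap F (fmap U x))
        (fmap F p) (fmap F q).

(* Main.v *)
From Stdlib Require Import FinFun List ssreflect.
Require Import Defs.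

Set Implicit Arguments.
Unset Strict Implicit.
Unset Printing Implicit Defensive.
Local Open Scope cat_scope.

(** Let [K] be the kernel of the regular epimorphism [U x : U E -> U F A].
    The reflective subcategory is closed under kernels, so [eta] is invertible
    at [K], [U E] and [U F A], and the extension [K -> U E -> U F A] is
    isomorphic to its image under [L]; in particular it is [L]-flat.
    Conditional flatness applied to its pullback along [eta_A] makes
    [L K -> L P -> L A] an extension, and the short five lemma, applied to its
    map to [L K -> L U E -> L U F A], shows that [L q] is invertible.  As
    [L eta_A] is invertible too, the image square has two parallel
    isomorphisms and is therefore a pullback. *)

(** * Finite limits *)

Inductive cospan_obj := cospan_left | cospan_right | cospan_apex.

(** The shape left -> apex <- right as a thin category, so that every category law is an instance of
    [cospan_hom_eq]. *)
Definition cospan_hom (i j : cospan_obj) : Type :=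
  match i, j with
  | cospan_left, cospan_left | cospan_right, cospan_right
  | _, cospan_apex => unit
  | _, _ => Empty_set
  end.

Definition cospan_id (i : cospan_obj) : cospan_hom i i :=
  match i with cospan_left | cospan_right | cospan_apex => tt end.

Definition cospan_comp (i j k : cospan_obj) :
  cospan_hom j k -> cospan_hom i j -> cospan_hom i k.
Proof. by case: i; case: j; case: k. Defined.

Lemma cospan_hom_eq (i j : cospan_obj) (a b : cospan_hom i j) : a = b.
Proof. by move: a b; case: i; case: j => -[] []. Qed.

Definition cospan : category :=
  @Category cospan_obj cospan_hom cospan_id cospan_comp
    (fun _ _ _ => cospan_hom_eq _ _) (fun _ _ _ => cospan_hom_eq _ _)
    (fun _ _ _ _ _ _ _ => cospan_hom_eq _ _).

Lemma cospan_finite : finite_category cospan.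
Proof.
split.
  by exists (cospan_left :: cospan_right :: cospan_apex :: nil); case; cbn; auto.
by case; case; solve [ by exists (tt :: nil); case; left | by exists nil; case ].
Qed.

Section CospanDiagram.
Variables (C : category) (A B S : C) (f : hom A S) (g : hom B S).

Definition cospan_diagram_obj (i : cospan) : C :=
  match i with cospan_left => A | cospan_right => B | cospan_apex => S end.

Definition cospan_diagram_hom (i j : cospan) :
    hom i j -> hom (cospan_diagram_obj i) (cospan_diagram_obj j) :=
  match i, j with
  | cospan_left, cospan_left => fun _ => idm A
  | cospan_right, cospan_right => fun _ => idm B
  | cospan_apex, cospan_apex => fun _ => idm S
  | cospan_left, cospan_apex => fun _ => f
  | cospan_right, cospan_apex => fun _ => g
  | _, _ => fun a => match a with end
  end.

Lemma cospan_diagram_id (i : cospan) :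
  cospan_diagram_hom (idm i) = idm (cospan_diagram_obj i).
Proof. by case: i. Qed.

Lemma cospan_diagram_comp (i j k : cospan) (b : hom j k) (a : hom i j) :
  cospan_diagram_hom (b ∘ a) = cospan_diagram_hom b ∘ cospan_diagram_hom a.
Proof.
move: b a; case: i; case: j; case: k => -[] [] /=;
  by rewrite ?comp_idl ?comp_idr.
Qed.

Definition cospan_diagram : functor cospan C :=
  Functor cospan_diagram_id cospan_diagram_comp.

End CospanDiagram.

(** A limit cone over the cospan has a third leg, to [S]; the cone condition forces it to be [f]
    after the left leg, so it carries no extra data. *)
Lemma pullback_exists (C : category) (hC : finitely_complete C)
    (A B S : C) (f : hom A S) (g : hom B S) :
  exists (P : C) (p : hom P A) (q : hom P B), is_pullback f g p q.
Proof.
have [P [pi [pi_cone pi_univ]]] := hC _ (cospan_diagram f g) cospan_finite.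
have pl := pi_cone cospan_left cospan_apex tt.
have pr := pi_cone cospan_right cospan_apex tt.
exists P, (pi cospan_left), (pi cospan_right); split.
  exact: (eq_trans pl (eq_sym pr)).
move=> T a b ab.
pose t (i : cospan) : hom T (cospan_diagram f g i) :=
  match i with
  | cospan_left => a | cospan_right => b | cospan_apex => f ∘ a
  end.
have t_cone i j (c : hom i j) : fmap (cospan_diagram f g) c ∘ t i = t j.
  by move: c; case: i; case: j => -[] /=; rewrite ?comp_idl.
have [u [hu uniq_u]] := pi_univ T t t_cone.
exists u; split.
  by split; [apply: (hu cospan_left) | apply: (hu cospan_right)].
move=> v [va vb]; apply: uniq_u; case => //=.
by rewrite -pl -comp_assoc; apply: (f_equal (fun h => f ∘ h)).
Qed.

(** * Isomorphisms, pullbacks and zero morphisms *)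

Lemma pullback_sym (C : category) (A B S P : C) (f : hom A S) (g : hom B S)
    (p : hom P A) (q : hom P B) :
  is_pullback f g p q -> is_pullback g f q p.
Proof.
move=> [e univ]; split => // T a b ab.
have [u [[ua ub] uniq_u]] := univ T b a (eq_sym ab).
by exists u; split => // v [va vb]; apply: uniq_u.
Qed.

Lemma pullback_joint_mono (C : category) (A B S P : C) (f : hom A S)
    (g : hom B S) (p : hom P A) (q : hom P B) (T : C) (a b : hom T P) :
  is_pullback f g p q -> p ∘ a = p ∘ b -> q ∘ a = q ∘ b -> a = b.
Proof.
move=> [e univ] pab qab.
have [|u [_ uniq_u]] := univ T (p ∘ b) (q ∘ b).
  by rewrite !comp_assoc e.
by rewrite -(uniq_u a) // -(uniq_u b).
Qed.

Lemma pullback_of_isos (C : category) (A B S P : C) (f : hom A S)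
    (g : hom B S) (p : hom P A) (q : hom P B) :
  iso f -> iso q -> f ∘ p = g ∘ q -> is_pullback f g p q.
Proof.
move=> [f' [f'f ff']] [q' [q'q qq']] e; split => // T a b ab.
exists (q' ∘ b); split.
  split; last by rewrite comp_assoc qq' comp_idl.
  rewrite -(comp_idl a) -f'f -comp_assoc ab.
  by rewrite -(comp_idl (p ∘ _)) -f'f -comp_assoc (comp_assoc f p) e
    -(comp_assoc g) (comp_assoc q) qq' comp_idl.
by move=> v [_ <-]; rewrite comp_assoc q'q comp_idl.
Qed.

Lemma iso_id (C : category) (A : C) : iso (idm A).
Proof. by exists (idm A); rewrite comp_idl. Qed.

Lemma iso_mono (C : category) (A B : C) (f : hom A B) : iso f -> mono f.
Proof.
move=> [g [gf _]] T a b ab.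
by rewrite -(comp_idl a) -(comp_idl b) -gf -!comp_assoc ab.
Qed.

(** As [m] is mono, [g] coequalizes the pair defining [m ∘ g] and so factors through it by some [u].
    Uniqueness in the coequalizer makes [u] a section of [m], and a mono with a section is
    invertible. *)
Lemma regular_epi_strong (C : category) (A B I : C) (g : hom A I) (m : hom I B) :
  regular_epi (m ∘ g) -> mono m -> iso m.
Proof.
move=> [R [a [b [e univ]]]] m_mono.
have [|u [hu _]] := univ I g; first by apply: m_mono; rewrite !comp_assoc.
have [v [_ uniq_v]] := univ B (m ∘ g) e.
have mu : m ∘ u = idm B.
  rewrite -(uniq_v (idm B)) ?comp_idl //; symmetry; apply: uniq_v.
  by rewrite -comp_assoc hu.
exists u; split => //; apply: m_mono.
by rewrite comp_assoc mu comp_idl comp_idr.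
Qed.

Lemma zero_morphism_unique (C : category) (A B : C) (f g : hom A B) :
  zero_morphism f -> zero_morphism g -> f = g.
Proof.
move=> [Z [hZ [h [k ->]]]] [Z' [hZ' [h' [k' ->]]]].
(* The two morphisms may factor through different zero objects; [w] compares them. *)
have [_ [w _]] := hZ Z'.
have [[a [_ ua]] _] := hZ' A.
have [_ [b [_ ub]]] := hZ B.
rewrite -(ub h) // (ub (h' ∘ w)) // -comp_assoc.
by rewrite -(ua (w ∘ k)) // (ua k').
Qed.

Lemma zero_morphism_compl (C : category) (A B D : C) (g : hom B D) (f : hom A B) :
  zero_morphism f -> zero_morphism (g ∘ f).
Proof.
move=> [Z [hZ [h [k ->]]]]; exists Z; split => //.
by exists (g ∘ h), k; rewrite comp_assoc.
Qed.

Lemma zero_morphism_compr (C : category) (A B D : C) (g : hom B D) (f : hom A B) :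
  zero_morphism g -> zero_morphism (g ∘ f).
Proof.
move=> [Z [hZ [h [k ->]]]]; exists Z; split => //.
by exists h, (k ∘ f); rewrite comp_assoc.
Qed.

Lemma zero_morphism_exists (C : category) (hZ : exists Z : C, is_zero_object Z)
    (A B : C) : exists f : hom A B, zero_morphism f.
Proof.
have [Z zZ] := hZ; have [[k _] _] := zZ A; have [_ [h _]] := zZ B.
by exists (h ∘ k), Z; split => //; exists h, k.
Qed.

(** The equalizer is the pullback of the graphs [(1, f)] and [(1, g)] into [A × B], the product
    being a pullback over the zero object. *)
Lemma equalizer_exists (C : category) (hZ : exists Z : C, is_zero_object Z)
    (hC : finitely_complete C) (A B : C) (f g : hom A B) :
  exists (E : C) (m : hom E A), mono m /\ f ∘ m = g ∘ m /\
    forall (T : C) (t : hom T A), f ∘ t = g ∘ t -> exists u : hom T E, m ∘ u = t.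
Proof.
have [Z zZ] := hZ.
have [[zA [_ uA]] _] := zZ A; have [[zB _] _] := zZ B.
have toZ T (a b : hom T Z) : a = b.
  by have [[c [_ uc]] _] := zZ T; rewrite -(uc a) // -(uc b).
have [AB [p1 [p2 hAB]]] := pullback_exists hC zA zB.
have graph (h : hom A B) : exists u : hom A AB, p1 ∘ u = idm A /\ p2 ∘ u = h.
  have [|u [hu _]] := proj2 hAB A (idm A) h; first exact: toZ.
  by exists u.
have [u [u1 u2]] := graph f; have [v [v1 v2]] := graph g.
have [E [m [m' hE]]] := pullback_exists hC u v.
(* Both graphs have first component the identity, so the two projections coincide. *)
have mm' : m = m'.
  by rewrite -(comp_idl m) -u1 -comp_assoc (proj1 hE) comp_assoc v1 comp_idl.
move: hE; rewrite -{}mm' => hE; exists E, m; split; [|split].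
- by move=> T a b ab; apply: (pullback_joint_mono hE).
- by rewrite -u2 -v2 -!comp_assoc (proj1 hE).
- move=> T t ft; have [|w [[hw _] _]] := proj2 hE T t t; last by exists w.
  by apply: (pullback_joint_mono hAB); rewrite !comp_assoc ?u1 ?v1 ?u2 ?v2.
Qed.

(** * Kernels and cokernels *)

Lemma kernel_mono (C : category) (K A B : C) (k : hom K A) (f : hom A B) :
  is_kernel k f -> mono k.
Proof.
move=> [fk univ] T a b ab.
have [|u [_ uniq_u]] := univ T (k ∘ a).
  by rewrite comp_assoc; apply: zero_morphism_compr.
by rewrite -(uniq_u a) // (uniq_u b).
Qed.

Lemma zero_morphism_cancel (C : category) (hZ : exists Z : C, is_zero_object Z)
    (A B D : C) (m : hom B D) (f : hom A B) :
  mono m -> zero_morphism (m ∘ f) -> zero_morphism f.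
Proof.
move=> m_mono mf; have [z hz] := zero_morphism_exists hZ A B.
rewrite (m_mono _ f z) //.
by apply: zero_morphism_unique => //; apply: zero_morphism_compl.
Qed.

Lemma is_kernelI (C : category) (K A B : C) (k : hom K A) (f : hom A B) :
  mono k -> zero_morphism (f ∘ k) ->
  (forall (T : C) (t : hom T A), zero_morphism (f ∘ t) ->
     exists u : hom T K, k ∘ u = t) ->
  is_kernel k f.
Proof.
move=> k_mono fk univ; split => // T t /univ [u hu].
by exists u; split => // v hv; apply: k_mono; rewrite hu hv.
Qed.

Lemma kernel_exists (C : category) (hC : homological C)
    (A B : C) (f : hom A B) :
  exists (K : C) (k : hom K A), is_kernel k f.
Proof.
have hZ := homological_pointed hC.
have [z hz] := zero_morphism_exists hZ A B.
have [K [k [k_mono [fk univ]]]] :=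
  equalizer_exists hZ (regular_finitely_complete (homological_regular hC)) f z.
exists K, k; apply: is_kernelI => //.
  by rewrite fk; apply: zero_morphism_compr.
move=> T t ft; apply: univ; apply: zero_morphism_unique => //.
exact: zero_morphism_compr.
Qed.

Lemma pullback_kernel (C : category) (A B S P K : C) (f : hom A S)
    (g : hom B S) (p : hom P A) (q : hom P B) (k : hom K B) (j : hom K P) :
  is_pullback f g p q -> is_kernel k g -> zero_morphism (p ∘ j) -> q ∘ j = k ->
  is_kernel j p.
Proof.
move=> pb kg pj qj; apply: is_kernelI => //.
  move=> T a b ab; apply: (kernel_mono kg).
  by rewrite -qj -!comp_assoc ab.
move=> T t pt.
have [|u [hu _]] := proj2 kg T (q ∘ t).
  by rewrite comp_assoc -(proj1 pb) -comp_assoc; apply: zero_morphism_compl.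
exists u; apply: (pullback_joint_mono pb); rewrite comp_assoc ?qj //.
by apply: zero_morphism_unique => //; apply: zero_morphism_compr.
Qed.

Lemma kernel_iso (C : category) (K A B K' A' B' : C)
    (k : hom K A) (f : hom A B) (k' : hom K' A') (f' : hom A' B')
    (i : hom K K') (j : hom A A') (l : hom B B') :
  iso i -> iso j -> iso l -> j ∘ k = k' ∘ i -> l ∘ f = f' ∘ j ->
  is_kernel k f -> is_kernel k' f'.
Proof.
move=> [i' [i'i ii']] [j' [j'j jj']] [l' [l'l ll']] jk lf kf.
have k'E : k' = j ∘ k ∘ i' by rewrite jk -comp_assoc ii' comp_idr.
have f'E : f' = l ∘ f ∘ j' by rewrite lf -comp_assoc jj' comp_idr.
apply: is_kernelI.
- rewrite k'E => T a b ab.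
  have i'_mono : mono i' by apply: iso_mono; exists i.
  have j_mono : mono j by apply: iso_mono; exists j'.
  apply/i'_mono/(kernel_mono kf)/j_mono.
  by rewrite !comp_assoc.
- have -> : f' ∘ k' = l ∘ ((f ∘ k) ∘ i').
    by rewrite k'E !comp_assoc -lf -!comp_assoc.
  apply: zero_morphism_compl; apply: zero_morphism_compr; exact: (proj1 kf).
- move=> T t f't.
  have [|u [hu _]] := proj2 kf T (j' ∘ t).
    have -> : f ∘ (j' ∘ t) = l' ∘ (f' ∘ t).
      by rewrite f'E !comp_assoc l'l comp_idl.
    exact: zero_morphism_compl.
  exists (i ∘ u).
  by rewrite comp_assoc -jk -comp_assoc hu comp_assoc jj' comp_idl.
Qed.

Lemma cokernel_iso (C : category) (A B Q A' B' Q' : C)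
    (q : hom B Q) (f : hom A B) (q' : hom B' Q') (f' : hom A' B')
    (i : hom A A') (j : hom B B') (l : hom Q Q') :
  iso i -> iso j -> iso l -> j ∘ f = f' ∘ i -> l ∘ q = q' ∘ j ->
  is_cokernel q f -> is_cokernel q' f'.
Proof.
move=> [i' [i'i ii']] [j' [j'j jj']] [l' [l'l ll']] jf lq [qf univ].
have f'E : f' = j ∘ f ∘ i' by rewrite jf -comp_assoc ii' comp_idr.
have q'E : q' = l ∘ q ∘ j' by rewrite lq -comp_assoc jj' comp_idr.
split.
  have -> : q' ∘ f' = l ∘ ((q ∘ f) ∘ i').
    by rewrite f'E !comp_assoc -lq -!comp_assoc.
  by apply: zero_morphism_compl; apply: zero_morphism_compr.
move=> T t tf'.
have [|u [hu uniq_u]] := univ T (t ∘ j).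
  by rewrite -comp_assoc jf comp_assoc; apply: zero_morphism_compr.
exists (u ∘ l'); split.
  by rewrite q'E -!comp_assoc (comp_assoc l') l'l comp_idl
    comp_assoc hu -comp_assoc jj' comp_idr.
move=> v hv; rewrite (uniq_u (v ∘ l)) -?comp_assoc ?ll' ?comp_idr //.
by rewrite lq comp_assoc hv.
Qed.

Lemma extension_iso (C : category) (K E Q K' E' Q' : C)
    (k : hom K E) (q : hom E Q) (k' : hom K' E') (q' : hom E' Q')
    (i : hom K K') (j : hom E E') (l : hom Q Q') :
  iso i -> iso j -> iso l -> j ∘ k = k' ∘ i -> l ∘ q = q' ∘ j ->
  extension k q -> extension k' q'.
Proof.
move=> hi hj hl jk lq [kq qk]; split.
  exact: (kernel_iso hi hj hl jk lq kq).
exact: (cokernel_iso hi hj hl jk lq qk).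
Qed.

Lemma cokernel_regular_epi (C : category) (hZ : exists Z : C, is_zero_object Z)
    (A B Q : C) (q : hom B Q) (f : hom A B) :
  is_cokernel q f -> regular_epi q.
Proof.
move=> [qf univ]; have [z hz] := zero_morphism_exists hZ A B.
exists A, f, z; split.
  by apply: zero_morphism_unique => //; apply: zero_morphism_compl.
by move=> T t tf; apply: univ; rewrite tf; apply: zero_morphism_compl.
Qed.

(** * Homological categories *)

Section Homological.
Variables (C : category) (hC : homological C).

Let hZ : exists Z : C, is_zero_object Z := homological_pointed hC.
Let hlim : finitely_complete C :=
  regular_finitely_complete (homological_regular hC).

(* That is, the kernel and the section of a split epimorphism are jointly
   strongly epimorphic. *)
Lemma split_epi_subobject_iso (K A B M : C) (k : hom K A) (p : hom A B)
    (s : hom B A) (m : hom M A) (k0 : hom K M) (s0 : hom B M) :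
  p ∘ s = idm B -> is_kernel k p -> mono m -> m ∘ k0 = k -> m ∘ s0 = s -> iso m.
Proof.
move=> ps kp m_mono mk ms.
(* View [m] as a morphism from the split epimorphism [p ∘ m] to [p], with identities on kernels and
   on bases; it remains to see that [k0] is a kernel of [p ∘ m]. *)
apply: (homological_split_short_five hC (k := k0) (p := p ∘ m) (s := s0)
  (k' := k) (p' := p) (s' := s) (u := idm K) (w := idm B)) => //;
  rewrite ?comp_idl ?comp_idr //; try exact: iso_id.
  by rewrite -comp_assoc ms.
apply: is_kernelI.
- by move=> T a b ab; apply: (kernel_mono kp); rewrite -mk -!comp_assoc ab.
- by rewrite -comp_assoc mk; apply: (proj1 kp).
- move=> T t pmt; have [|u [hu _]] := proj2 kp T (m ∘ t).
    by rewrite comp_assoc.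
  by exists u; apply: m_mono; rewrite comp_assoc mk.
Qed.

(** The diagonal [d] of the kernel pair is a subobject containing the section of [p1] and also its
    kernel, which is zero. Hence [d] is invertible and the two projections agree. *)
Lemma mono_of_trivial_kernel (A B : C) (f : hom A B) :
  (forall (T : C) (t : hom T A), zero_morphism (f ∘ t) -> zero_morphism t) ->
  mono f.
Proof.
move=> f_triv.
have [R [p1 [p2 hR]]] := pullback_exists hlim f f.
have [d [[d1 d2] _]] := proj2 hR A (idm A) (idm A) eq_refl.
have [K [k kp1]] := kernel_exists hC p1.
have [z hz] := zero_morphism_exists hZ K A.
have p1k := proj1 kp1.
have p2k : zero_morphism (p2 ∘ k).
  apply: f_triv; rewrite comp_assoc -(proj1 hR) -comp_assoc.
  exact: zero_morphism_compl.
have dz : d ∘ z = k.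
  apply: (pullback_joint_mono hR); apply: zero_morphism_unique => //;
    rewrite comp_assoc; exact: zero_morphism_compl.
have d_mono : mono d.
  by move=> T a b ab; rewrite -(comp_idl a) -(comp_idl b) -d1 -!comp_assoc ab.
have [e [_ de]] :=
  split_epi_subobject_iso d1 kp1 d_mono dz (comp_idr d).
have p12 : p1 = p2.
  by rewrite -(comp_idr p1) -(comp_idr p2) -de !comp_assoc d1 d2.
move=> T a b ab; have [u [[<- <-] _]] := proj2 hR T a b ab.
by rewrite p12.
Qed.

(** The kernel of [f] is trivial, so [f] is mono. To see that it is also a strong epimorphism, pull
    back along [p]: the first projections become split, and the comparison [m] from [A ×_B A] to
    [A ×_B A'] is a subobject containing the kernel and a section, hence invertible. *)
Lemma short_five_over (K A A' B : C) (k : hom K A) (p : hom A B)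
    (k' : hom K A') (p' : hom A' B) (f : hom A A') :
  is_kernel k p -> is_kernel k' p' -> regular_epi p ->
  f ∘ k = k' -> p' ∘ f = p -> iso f.
Proof.
move=> kp kp' p_epi fk pf.
have f_mono : mono f.
  apply: mono_of_trivial_kernel => T t ft.
  have [|u [hu _]] := proj2 kp T t.
    by rewrite -pf -comp_assoc; apply: zero_morphism_compl.
  rewrite -hu; apply: zero_morphism_compl.
  apply: (zero_morphism_cancel hZ (kernel_mono kp')).
  by rewrite -fk -comp_assoc hu.
have [Q [r1 [r2 hQ]]] := pullback_exists hlim p p'.
have [R [p1 [p2 hR]]] := pullback_exists hlim p p.
have [|m [[m1 m2] _]] := proj2 hQ R p1 (f ∘ p2).
  by rewrite comp_assoc pf (proj1 hR).
have m_mono : mono m.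
  move=> T a b ab; apply: (pullback_joint_mono hR).
    by rewrite -m1 -!comp_assoc ab.
  by apply: f_mono; rewrite !comp_assoc -m2 -!comp_assoc ab.
have [d [[d1 d2] _]] := proj2 hR A (idm A) (idm A) eq_refl.
have [z hz] := zero_morphism_exists hZ K A.
(* [j] is [(0, k)]; its image under [m] is [(0, k')], the kernel of [r1]. *)
have [|j [[j1 j2] _]] := proj2 hR K z k.
  apply: zero_morphism_unique; last exact: (proj1 kp).
  exact: zero_morphism_compl.
have r1mj : zero_morphism (r1 ∘ (m ∘ j)) by rewrite comp_assoc m1 j1.
have r2mj : r2 ∘ (m ∘ j) = k'.
  by rewrite comp_assoc m2 -comp_assoc j2.
have r1md : r1 ∘ (m ∘ d) = idm A by rewrite comp_assoc m1.
have [n [_ mn]] := split_epi_subobject_iso r1md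
  (pullback_kernel hQ kp' r1mj r2mj) m_mono eq_refl eq_refl.
apply: (@regular_epi_strong _ _ _ _ (p2 ∘ n)) => //.
(* The projection [r2] is a regular epimorphism, being a pullback of [p], and it factors through the
   mono [f]. *)
have -> : f ∘ (p2 ∘ n) = r2.
  by rewrite comp_assoc -m2 -comp_assoc mn comp_idr.
exact: (regular_epi_stable (homological_regular hC) hQ).
Qed.

(** Replacing [p] by [w ∘ p] and [k'] by [k' ∘ u] reduces to a morphism over a fixed base and with a
    fixed kernel. *)
Lemma short_five (K A B K' A' B' : C) (k : hom K A) (p : hom A B)
    (k' : hom K' A') (p' : hom A' B') (u : hom K K') (f : hom A A')
    (w : hom B B') :
  extension k p -> extension k' p' -> f ∘ k = k' ∘ u -> w ∘ p = p' ∘ f ->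
  iso u -> iso w -> iso f.
Proof.
move=> kp [kp' _] fk wp hu hw.
have [kwp wpk] : extension k (w ∘ p).
  apply: (extension_iso (iso_id K) (iso_id A) hw _ _ kp);
    by rewrite ?comp_idl ?comp_idr.
have [u' [u'u uu']] := hu.
have k'u : is_kernel (k' ∘ u) p'.
  apply: (kernel_iso (i := u') (j := idm A') (l := idm B') _ _ _ _ _ kp');
    rewrite ?comp_idl ?comp_idr -?comp_assoc ?uu' ?comp_idr //;
    try exact: iso_id.
  by exists u.
exact: (short_five_over kwp k'u (cokernel_regular_epi hZ wpk) fk (eq_sym wp)).
Qed.

(** The pair coequalized by [f] factors through its kernel pair, so it suffices that [t] coequalizes
    [p1] and [p2]. The equalizer of [t ∘ p1] and [t ∘ p2] contains the diagonal and the kernel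
    [(0, k)] of [p1], hence is everything. *)
Lemma regular_epi_extension (K A B : C) (k : hom K A) (f : hom A B) :
  regular_epi f -> is_kernel k f -> extension k f.
Proof.
move=> [S [a [b [fab univ]]]] kf; split => //; split; first exact: (proj1 kf).
move=> T t tk; apply: univ.
have [R [p1 [p2 hR]]] := pullback_exists hlim f f.
have [c [[<- <-] _]] := proj2 hR S a b fab.
suff tp : t ∘ p1 = t ∘ p2 by rewrite !comp_assoc tp.
have [E [m [m_mono [tm m_univ]]]] := equalizer_exists hZ hlim (t ∘ p1) (t ∘ p2).
have [d [[d1 d2] _]] := proj2 hR A (idm A) (idm A) eq_refl.
have [z hz] := zero_morphism_exists hZ K A.
have [|j [[j1 j2] _]] := proj2 hR K z k.
  apply: zero_morphism_unique; last exact: (proj1 kf).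
  exact: zero_morphism_compl.
have [|d0 md] := m_univ _ d; first by rewrite -!comp_assoc d1 d2.
have [|j0 mj] := m_univ _ j.
  rewrite -!comp_assoc j1 j2; apply: zero_morphism_unique => //.
  exact: zero_morphism_compl.
have jp1 : is_kernel j p1.
  by apply: (pullback_kernel hR kf) => //; rewrite j1.
have [n [_ mn]] := split_epi_subobject_iso d1 jp1 m_mono mj md.
by rewrite -(comp_idr (t ∘ p1)) -(comp_idr (t ∘ p2)) -mn !(comp_assoc _ m) tm.
Qed.

End Homological.

(** * Full reflective subcategories *)

Section Reflection.
Variables (C : category) (P : C -> Prop) (F : functor C (full_subcategory P))
  (eta : nat_trans (functor_id C) (functor_comp (inclusion P) F)).
Hypothesis hF : adjunction_unit eta.

Let L : functor C C := functor_comp (inclusion P) F.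

Lemma unit_natural (A B : C) (f : hom A B) : fmap L f ∘ eta A = eta B ∘ f.
Proof. exact: (eq_sym (naturality eta f)). Qed.

Lemma unit_cancel (A : C) (Y : full_subcategory P)
    (g h : hom (L A) (inclusion P Y)) :
  g ∘ eta A = h ∘ eta A -> g = h.
Proof.
move=> gh; have [u [_ uniq_u]] := hF (h ∘ eta A : hom A (inclusion P Y)).
exact: (eq_trans (eq_sym (uniq_u g gh)) (uniq_u h eq_refl)).
Qed.

(** The composite [eta A ∘ r] and the identity agree after precomposition with [eta A], so they are
    equal by the universal property. *)
Lemma unit_iso_of_retraction (A : C) (r : hom (L A) A) :
  r ∘ eta A = idm A -> iso (eta A : hom A (L A)).
Proof.
move=> re; exists r; split => //.
apply: (@unit_cancel A (F A)).
by rewrite -comp_assoc re comp_idl comp_idr.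
Qed.

Lemma unit_iso_inclusion (Y : full_subcategory P) :
  iso (eta (inclusion P Y) : hom _ (L (inclusion P Y))).
Proof.
have [r [hr _]] := hF (idm (inclusion P Y)).
exact: (unit_iso_of_retraction hr).
Qed.

(** Naturality of the unit at [eta A] identifies this morphism with [eta (L A)], the unit at an
    object of the subcategory. *)
Lemma reflector_unit_iso (A : C) : iso (fmap L (eta A : hom A (L A))).
Proof.
have -> : fmap L (eta A : hom A (L A)) = eta (L A).
  apply: (@unit_cancel A (F (L A))); exact: unit_natural.
exact: (unit_iso_inclusion (F A)).
Qed.

(** Closure under kernels, stated through the unit because [P] need not be closed under isomorphism.
    The extension [k1] of [k] along [eta K] is still killed by [x], so it factors through [k], and
    the factor is a retraction of the unit. *)
Lemma unit_iso_kernel (hZ : exists Z : C, is_zero_object Z)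
    (Y Y' : full_subcategory P) (x : hom Y Y') (K : C)
    (k : hom K (inclusion P Y)) :
  is_kernel k (fmap (inclusion P) x) -> iso (eta K : hom K (L K)).
Proof.
move=> kx.
have [k1 [hk1 _]] := hF k.
have [z hz] := zero_morphism_exists hZ (L K) (inclusion P Y').
have xk1 : fmap (inclusion P) x ∘ fmap (inclusion P) k1 = z.
  apply: (@unit_cancel K Y'); rewrite -comp_assoc hk1.
  apply: zero_morphism_unique; first exact: (proj1 kx).
  exact: zero_morphism_compr.
have [|r [hr _]] := proj2 kx (L K) (fmap (inclusion P) k1); first by rewrite xk1.
apply: (@unit_iso_of_retraction K r).
by apply: (kernel_mono kx); rewrite comp_assoc hr comp_idr.
Qed.

End Reflection.

Theorem proposition4p4 (C : category) (hC : homological C)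
  (P : C -> Prop) (F : functor C (full_subcategory P))
  (eta : nat_trans (functor_id C) (functor_comp (inclusion P) F))
  (hF : adjunction_unit eta)
  (hL : conditionally_flat (functor_comp (inclusion P) F)) :
  admissible_regular_epi eta.
Proof.
move=> A E x x_epi Q p q pb.
set L := functor_comp (inclusion P) F in hL.
have hZ := homological_pointed hC.
have [K [k kx]] := kernel_exists hC (fmap (inclusion P) x).
have ext := regular_epi_extension hC x_epi kx.
have ext_flat : flat L k (fmap (inclusion P) x).
  (* The components of [eta] form the isomorphism from this extension to its image under [L]. *)
  apply: (extension_iso (unit_iso_kernel hF hZ kx) (unit_iso_inclusion hF E)
    (unit_iso_inclusion hF (F A)) _ _ ext); symmetry; exact: unit_natural.
have [z hz] := zero_morphism_exists hZ K A.
(* [k'] is [(0, k)], the kernel part of the pulled back extension. *)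
have [|k' [[pk' qk'] _]] := proj2 pb K z k.
  apply: zero_morphism_unique; last exact: (proj1 kx).
  exact: zero_morphism_compl.
have ext' : flat L k' p.
  apply: (hL _ _ _ _ _ ext ext_flat _ _ _ _ _ _ (pullback_sym pb) qk').
  by rewrite pk'.
have Lsquare : fmap L (eta A : hom A (L A)) ∘ fmap L p =
    fmap L (fmap (inclusion P) x) ∘ fmap L q.
  by rewrite -!fmap_comp (proj1 pb).
have Lq_iso : iso (fmap L q).
  (* The map on kernels is the identity of [L K], since [q ∘ k' = k]. *)
  apply: (short_five hC ext' ext_flat _ Lsquare (iso_id _)
    (reflector_unit_iso hF A)).
  by rewrite -fmap_comp qk' comp_idr.
(* By fullness, isomorphisms of [C] between objects of the subcategory are isomorphisms there, so
   the pullback is formed in the subcategory. *)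
exact: (pullback_of_isos (C := full_subcategory P)
  (reflector_unit_iso hF A) Lq_iso Lsquare).
Qed.
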